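(* Let $\lambda$ be a positive integer, let $a,b\in\{0,1,\dots,2\lambda\}$, and call a relation on a $k$-MOFS$(2\lambda)$ square-nontrivial if it is non-trivial on each of the columns $3,\dots,k+2$. Then: (i) there exists a $1$-MOFS$(2\lambda)$ with a square-nontrivial relation satisfying $|X_1|=a$, $|X_2|=b$ if and only if $a=b=\lambda$; (ii) there exists a $2$-MOFS$(2\lambda)$ with a square-nontrivial relation satisfying $|X_1|=a$, $|X_2|=b$ if and only if each of $\lambda,a,b$ is even and ($a=\lambda$ or $b=\lambda$); (iii) there exists a $3$-MOFS$(2\lambda)$ with a square-nontrivial relation satisfying $|X_1|=a$, $|X_2|=b$ if and only if each of $\lambda,a,b$ is even.
   Context: Let $N(n)=\{1,\dots,n\}$ and let $n$ be even. A (binary) frequency square of order $n$ is an $n\times n$ array indexed by $N(n)\times N(n)$ with entries in $\{0,1\}$ such that every row and every column contains exactly $n/2$ zeros and $n/2$ ones. Two frequency squares $F,G$ of order $n$ are orthogonal if for each $(a,b)\in\{0,1\}^2$ the number of cells $(r,c)$ with $(F[r,c],G[r,c])=(a,b)$ equals $n^2/4$. A $k$-MOFS$(n)$ is an ordered set $F_1,\dots,F_k$ of pairwise orthogonal frequency squares of order $n$. Relations: form the $n^2\times(k+2)$ array $\mathcal O$ having a row $(i,j,F_1[i,j],\dots,F_k[i,j])$ for each $(i,j)\in N(n)^2$. Let $Y_1=Y_2=N(n)$ and $Y_c=\{0,1\}$ for $3\le c\le k+2$. A relation is a tuple $(X_1,\dots,X_{k+2})$ with $X_c\subseteq Y_c$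 for all $c$ such that every row of $\mathcal O$ has an even number of positions $c$ for which the $c$-th entry of the row lies in $X_c$. A relation is trivial on column $c$ if $X_c=\emptyset$ or $X_c=Y_c$. Two relations $(X_1,\dots,X_{k+2})$, $(X'_1,\dots,X'_{k+2})$ are equivalent if $|X_i|=|X'_i|$ for all $i$. *)

(* Defs.v *)
From mathcomp Require Import all_boot all_algebra.

Set Implicit Arguments.
Unset Strict Implicit.
Unset Printing Implicit Defensive.

(* N(n) is 'I_n, and the symbols 0 and 1 are false and true. *)
Definition freq_square (n : nat) (F : 'M[bool]_n) : Prop :=
  [/\ ~~ odd n,
      forall (r : 'I_n) (s : bool), #|[set c : 'I_n | F r c == s]| = n %/ 2
    & forall (c : 'I_n) (s : bool), #|[set r : 'I_n | F r c == s]| = n %/ 2].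

Definition orthogonal_squares (n : nat) (F G : 'M[bool]_n) : Prop :=
  forall s t : bool,
    #|[set rc : 'I_n * 'I_n | (F rc.1 rc.2, G rc.1 rc.2) == (s, t)]|
      = n ^ 2 %/ 4.

Definition is_MOFS (k n : nat) (F : 'I_k -> 'M[bool]_n) : Prop :=
  (forall i : 'I_k, freq_square (F i)) /\
  (forall i j : 'I_k, i != j -> orthogonal_squares (F i) (F j)).

(* The k + 2 columns of the array O: the first two are inl ord0 and
   inl ord_max, and column c + 3 (for c : 'I_k counted from 0) is inr c. *)
Definition column (k : nat) : finType := ('I_2 + 'I_k)%type.

Definition first_col (k : nat) : column k := inl ord0.
Definition second_col (k : nat) : column k := inl ord_max.
Definition square_col (k : nat) (c : 'I_k) : column k := inr c.

Definition colY (n k : nat) (c : column k) : finType :=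
  match c with inl _ => 'I_n | inr _ => bool end.

Definition array_entry (k n : nat) (F : 'I_k -> 'M[bool]_n)
    (ij : 'I_n * 'I_n) (c : column k) : colY n c :=
  match c return colY n c with
  | inl p => if p == ord0 then ij.1 else ij.2
  | inr m => F m ij.1 ij.2
  end.

Definition col_subsets (n k : nat) : Type :=
  forall c : column k, {set colY n c}.

Definition is_relation (k n : nat) (F : 'I_k -> 'M[bool]_n)
    (X : col_subsets n k) : Prop :=
  forall ij : 'I_n * 'I_n,
    ~~ odd #|[set c : column k | array_entry F ij c \in X c]|.

Definition trivial_on (k n : nat) (X : col_subsets n k) (c : column k) : Prop :=
  X c = set0 \/ X c = setT.

Definition square_nontrivial (k n : nat) (X : col_subsets n k) : Prop :=
  forall c : 'I_k, ~ trivial_on X (square_col c).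

(* Main.v *)
(** A square-nontrivial relation says that F_1 + ... + F_k = e + x_i + y_j
    modulo 2, where x and y are the indicators of X_1 and X_2.  Reading this
    along one row or column gives a = b = k * lambda modulo 2.  Summing signs
    over a line (k = 1) or over all cells (k = 2, 3) gives
    +-(2 lambda - 2 a)(2 lambda - 2 b) on the right; the left side vanishes for
    k = 2 by orthogonality and is 4 lambda^2 modulo 8 for k = 3, which forces
    lambda to be even.

    Conversely, squares of the form F_m[i,j] = p_m(i) + q_m(j) suffice: they
    are frequency squares when all p_m and q_m are balanced, F_m and F_m' are
    orthogonal when p_m + p_m' or q_m + q_m' is balanced, and the supports of
    the sums of the p_m and of the q_m provide the relation.  The functions p
    are encoded by the list whose i-th item is the word p_1(i) ... p_k(i), so
    that only the multiplicity of each word matters. *)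

Require Import Defs.
From mathcomp Require Import all_boot all_algebra.
From mathcomp Require Import zify.

Set Implicit Arguments.
Unset Strict Implicit.
Unset Printing Implicit Defensive.

Import GRing.Theory.
Local Open Scope ring_scope.

(** * Counting cells by sums of signs *)

Lemma card_sumz (T : finType) (f : T -> bool) :
  #|[set x | f x]|%:Z = \sum_x (f x)%:Z.
Proof.
rewrite cardsE -sum1_card big_mkcond (big_morph Posz PoszD (erefl 0)).
by apply: eq_bigr => x _; rewrite unfold_in; case: (f x).
Qed.

Lemma cardT_sumz (T : finType) : #|T|%:Z = \sum_(x : T) 1.
Proof. by rewrite sumr_const natz. Qed.

Lemma sum_sign_card (T : finType) (f : T -> bool) :
  \sum_x (-1) ^+ f x = #|T|%:Z - 2 * #|[set x | f x]|%:Z.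
Proof.
rewrite card_sumz cardT_sumz mulr_sumr -sumrB.
by apply: eq_bigr => x _; case: (f x).
Qed.

Lemma card_fiber_sign (T : finType) (f : T -> bool) (s : bool) :
  2 * #|[set x | f x == s]|%:Z = #|T|%:Z + (-1) ^+ s * \sum_x (-1) ^+ f x.
Proof.
(* Flipping [f] by [~~ s] reduces both fibres to counting the value [true]. *)
have -> : [set x | f x == s] = [set x | f x (+) ~~ s].
  by apply/setP => x; rewrite !inE; case: (f x) s => [] [].
have /= := sum_sign_card (fun x => f x (+) ~~ s).
under eq_bigr do rewrite signr_addb mulrC.
rewrite -mulr_sumr; set S := bigop _ _ _.
by case: s => /=; rewrite ?expr1 ?expr0; lia.
Qed.

Lemma card_fiber_balanced (T : finType) (f : T -> bool) (l : nat) :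
  #|T| = (2 * l)%N ->
  (forall s, #|[set x | f x == s]| = l) <-> \sum_x (-1) ^+ f x = 0 :> int.
Proof.
move=> Tl; have := card_fiber_sign f; rewrite Tl PoszM.
set S := bigop _ _ _ => E; split=> [fl|S0 s].
  by have := E false; rewrite fl expr0; lia.
by have := E s; rewrite S0; lia.
Qed.

(** Four times the indicator of the fibre is (1 + (-1)^(s + f x)) (1 + (-1)^(t + g x)); the terms on
    the right come from expanding this product. *)
Lemma card_fiber2_sign (T : finType) (f g : T -> bool) (s t : bool) :
  4 * #|[set x | (f x, g x) == (s, t)]|%:Z =
  #|T|%:Z + (-1) ^+ s * (\sum_x (-1) ^+ f x)
  + (-1) ^+ t * (\sum_x (-1) ^+ g x)
  + (-1) ^+ (s (+) t) * \sum_x (-1) ^+ (f x (+) g x).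
Proof.
rewrite card_sumz cardT_sumz !mulr_sumr -!big_split /=.
apply: eq_bigr => x _; rewrite xpair_eqE.
by case: (f x) (g x) s t => [] [] [] [].
Qed.

(** * Frequency squares and orthogonality as vanishing sign sums *)

Section Squares.
Variable l : nat.
Local Notation n := (2 * l)%N.
Implicit Types F G : 'M[bool]_n.

Lemma freq_square_sign F :
  freq_square F <->
  (forall r, \sum_c (-1) ^+ F r c = 0 :> int) /\
  (forall c, \sum_r (-1) ^+ F r c = 0 :> int).
Proof.
have n2 : (n %/ 2 = l)%N by rewrite mulKn.
have cardn := card_ord n.
split=> [[_ Fr Fc]|[Fr Fc]].
  by split=> x; apply/(card_fiber_balanced _ cardn) => s;
    rewrite ?Fr ?Fc.
split; first by rewrite mul2n odd_double.
  by move=> x s; rewrite n2; move: s; apply/(card_fiber_balanced (F x) cardn).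
by move=> x s; rewrite n2; move: s; apply/(card_fiber_balanced (F^~ x) cardn).
Qed.

Lemma freq_square_total F :
  freq_square F -> \sum_ij (-1) ^+ F ij.1 ij.2 = 0 :> int.
Proof.
move=> /freq_square_sign[Fr _].
rewrite -(pair_bigA _ (fun i j => (-1) ^+ F i j)) /=.
by rewrite big1.
Qed.

Lemma orthogonal_squares_sign F G : freq_square F -> freq_square G ->
  orthogonal_squares F G <->
  \sum_ij (-1) ^+ (F ij.1 ij.2 (+) G ij.1 ij.2) = 0 :> int.
Proof.
move=> /freq_square_total F0 /freq_square_total G0.
have E s t := card_fiber2_sign (fun ij : 'I_n * 'I_n => F ij.1 ij.2)
  (fun ij => G ij.1 ij.2) s t.
have n2 : (n ^ 2 = 4 * l ^ 2)%N by rewrite expnMn.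
move: E; rewrite F0 G0 card_prod card_ord mulnn n2 PoszM.
rewrite /orthogonal_squares n2 mulKn //; set S := bigop _ _ _ => E.
split=> [FG|S0 s t].
  by have := E true true; rewrite FG expr0; lia.
by have := E s t; rewrite S0 !mulr0 !addr0 => /mulfI H; case: (H isT).
Qed.

End Squares.

(** * Parity and sign identities implied by a relation *)

Lemma odd_card_addb (T : finType) (f : T -> bool) :
  odd #|[set x | f x]| = \big[addb/false]_x f x.
Proof.
rewrite cardsE -sum1_card big_mkcond /= (big_morph odd oddD (erefl _)).
by apply: eq_bigr => x _; rewrite unfold_in; case: (f x).
Qed.

(** Double counting modulo 2: summing all [g m i] by [m] gives [k * l], while summing by [i] gives
    the size of [A], because the constant [d] occurs [2 * l] times and cancels. *)
Lemma odd_card_addb_shift (k l : nat) (g : 'I_k -> 'I_(2 * l) -> bool)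
    (A : {set 'I_(2 * l)}) (d : bool) :
  (forall m, #|[set i | g m i == true]| = l) ->
  (forall i, \big[addb/false]_(m < k) g m i = d (+) (i \in A)) ->
  odd #|A| = odd (k * l).
Proof.
move=> gl gA.
have <- : [set i in A] = A by apply/setP => i; rewrite inE.
have -> : odd (k * l) = \big[addb/false]_(m < k) \big[addb/false]_i g m i.
  under eq_bigr => m _.
    rewrite -odd_card_addb; under eq_finset do rewrite -[g m _]eqb_id.
    rewrite gl; over.
  by rewrite big_const card_ord; elim: (k) => //= m <-; rewrite mulSn oddD.
rewrite exchange_big odd_card_addb; under [RHS]eq_bigr do rewrite gA.
rewrite big_split /= big_const card_ord (_ : iter _ _ _ = false) //.
by rewrite mul2n; elim: (l) => //= m ->; case: (d).
Qed.

Section Relations.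
Variables (k l : nat) (F : 'I_k -> 'M[bool]_(2 * l)).
Variable X : col_subsets (2 * l) k.
Let x (i : 'I_(2 * l)) := i \in X (first_col k).
Let y (j : 'I_(2 * l)) := j \in X (second_col k).

Lemma odd_card_columns (ij : 'I_(2 * l) * 'I_(2 * l)) :
  odd #|[set c : column k | array_entry F ij c \in X c]| =
  x ij.1 (+) y ij.2 (+)
  \big[addb/false]_(m < k) (F m ij.1 ij.2 \in X (square_col m)).
Proof.
rewrite odd_card_addb big_sumType /= !big_ord_recl big_ord0 addbF.
by rewrite /x /y (_ : lift ord0 ord0 = ord_max) //; apply: val_inj.
Qed.

(** A nontrivial subset of {0,1} is a singleton, so membership of a symbol in it is the symbol
    itself plus a constant bit, equal to 1 exactly when 0 belongs to the subset. The bit [e]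
    collects these constants. *)
Lemma relation_addb : is_relation F X -> square_nontrivial X ->
  exists e : bool, forall i j,
    \big[addb/false]_(m < k) F m i j = e (+) (x i (+) y j).
Proof.
move=> FX X0; exists (\big[addb/false]_(m < k) (false \in X (square_col m))).
move=> i j; have := FX (i, j); rewrite odd_card_columns /=.
suff -> : \big[addb/false]_(m < k) (F m i j \in X (square_col m)) =
    \big[addb/false]_(m < k) F m i j (+)
    \big[addb/false]_(m < k) (false \in X (square_col m)).
  by do 2![case: (\big[_/_]_(_ | _) _)]; case: (x i) (y j) => [] [].
rewrite -big_split; apply: eq_bigr => m _ /=.
have := X0 m; rewrite /trivial_on; set A : {set bool} := X (square_col m).
case fA: (false \in A); case tA: (true \in A).
- by case; right; apply/setP => -[]; rewrite inE ?fA ?tA.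
- by case: (F m i j); rewrite ?fA ?tA.
- by case: (F m i j); rewrite ?fA ?tA.
- by case; left; apply/setP => -[]; rewrite inE ?fA ?tA.
Qed.

Hypothesis FM : is_MOFS F.
Variable e : bool.
Hypothesis Fe :
  forall i j, \big[addb/false]_(m < k) F m i j = e (+) (x i (+) y j).

Lemma sum_addb_row i :
  \sum_j (-1) ^+ (\big[addb/false]_(m < k) F m i j) =
  (-1) ^+ (e (+) x i) * (2 * l%:Z - 2 * #|X (second_col k)|%:Z) :> int.
Proof.
under eq_bigr do rewrite Fe addbA signr_addb.
rewrite -mulr_sumr sum_sign_card card_ord PoszM.
by congr (_ * (_ - _ * Posz #|pred_of_set _|)); apply/setP => j; rewrite inE.
Qed.

Lemma sum_addb_col j :
  \sum_i (-1) ^+ (\big[addb/false]_(m < k) F m i j) =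
  (-1) ^+ (e (+) y j) * (2 * l%:Z - 2 * #|X (first_col k)|%:Z) :> int.
Proof.
under eq_bigr do rewrite Fe [x _ (+) _]addbC addbA signr_addb.
rewrite -mulr_sumr sum_sign_card card_ord PoszM.
by congr (_ * (_ - _ * Posz #|pred_of_set _|)); apply/setP => i; rewrite inE.
Qed.

Lemma sum_addb_cells :
  \sum_ij (-1) ^+ (\big[addb/false]_(m < k) F m ij.1 ij.2) =
  (-1) ^+ e * (2 * l%:Z - 2 * #|X (first_col k)|%:Z)
  * (2 * l%:Z - 2 * #|X (second_col k)|%:Z) :> int.
Proof.
rewrite -(pair_bigA _ (fun i j => (-1) ^+ (\big[addb/false]_(m < k) F m i j))).
rewrite /=; under eq_bigr do rewrite sum_addb_row signr_addb.
rewrite -mulr_suml -mulr_sumr sum_sign_card card_ord PoszM.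
congr (_ * (_ - _ * Posz #|pred_of_set _|) * _).
by apply/setP => j; rewrite inE.
Qed.

Lemma odd_relation_rows : (0 < l)%N -> odd #|X (first_col k)| = odd (k * l).
Proof.
move=> l0; have j : 'I_(2 * l) by exists 0%N; lia.
apply: (@odd_card_addb_shift _ _ (fun m i => F m i j) _ (e (+) y j)) => [m|i].
  by have [_ _ /(_ j true) ->] := FM.1 m; rewrite mulKn.
by rewrite Fe [x _ (+) _]addbC addbA.
Qed.

Lemma odd_relation_cols : (0 < l)%N -> odd #|X (second_col k)| = odd (k * l).
Proof.
move=> l0; have i : 'I_(2 * l) by exists 0%N; lia.
apply: (@odd_card_addb_shift _ _ (fun m => F m i) _ (e (+) x i)) => [m|j].
  by have [_ /(_ i true) -> _] := FM.1 m; rewrite mulKn.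
by rewrite Fe addbA.
Qed.

End Relations.

(** * Squares built from two lists of words *)

Lemma card_nth_count (T : Type) (x0 : T) (P : pred T) (s : seq T) (n : nat) :
  size s = n -> #|[set i : 'I_n | P (nth x0 s i)]| = count P s.
Proof.
move=> <-; rewrite cardsE -sum1_card -sum1_count (big_nth x0) big_mkord.
by apply: eq_bigl => i; rewrite unfold_in.
Qed.

Definition word_parity (k : nat) (w : seq bool) : bool :=
  \big[addb/false]_(m < k) nth false w m.

Section ProductSquares.
Variables (k l : nat) (L M : seq (seq bool)).
Hypotheses (sizeL : size L = (2 * l)%N) (sizeM : size M = (2 * l)%N).
Let p (m : 'I_k) (i : 'I_(2 * l)) := nth false (nth [::] L i) m.
Let q (m : 'I_k) (j : 'I_(2 * l)) := nth false (nth [::] M j) m.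

Definition product_squares (m : 'I_k) : 'M[bool]_(2 * l) :=
  \matrix_(i, j) (p m i (+) q m j).

Definition product_relation : col_subsets (2 * l) k := fun c =>
  match c return {set colY (2 * l) c} with
  | inl u => if u == ord0 then [set i : 'I__ | word_parity k (nth [::] L i)]
             else [set j : 'I__ | word_parity k (nth [::] M j)]
  | inr _ => [set true]
  end.

Lemma sum_sign_count (s : seq (seq bool)) (P : pred (seq bool)) :
  size s = (2 * l)%N -> count P s = l ->
  \sum_(i < 2 * l) (-1) ^+ P (nth [::] s i) = 0 :> int.
Proof.
move=> ss sl; rewrite sum_sign_card (card_nth_count _ _ ss) sl card_ord.
by rewrite PoszM subrr.
Qed.

Lemma product_MOFS :
  (forall m, (m < k)%N -> count (nth false ^~ m) L = l) ->
  (forall m, (m < k)%N -> count (nth false ^~ m) M = l) ->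
  (forall m m', (m < m' < k)%N ->
     count (fun w => nth false w m (+) nth false w m') L = l \/
     count (fun w => nth false w m (+) nth false w m') M = l) ->
  is_MOFS product_squares.
Proof.
move=> Ll Ml LMl.
have fsq m : freq_square (product_squares m).
  apply/freq_square_sign; split=> x.
    under eq_bigr do rewrite mxE signr_addb.
    by rewrite -mulr_sumr (sum_sign_count sizeM (Ml m _)) ?mulr0.
  under eq_bigr do rewrite mxE signr_addb.
  by rewrite -mulr_suml (sum_sign_count sizeL (Ll m _)) ?mul0r.
have orth (m m' : 'I_k) : (m < m')%N ->
    \sum_ij (-1) ^+ (product_squares m ij.1 ij.2 (+)
                     product_squares m' ij.1 ij.2) = 0 :> int.
  move=> mm'.
  (* The sign at a cell is a function of the row times a function of the column, so one balanced
     factor suffices. *)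
  transitivity ((\sum_i (-1) ^+ (p m i (+) p m' i)) *
                (\sum_j (-1) ^+ (q m j (+) q m' j)) : int).
    rewrite big_distrlr /= pair_bigA; apply: eq_bigr => -[i j] _ /=.
    by rewrite !mxE -signr_addb addbACA.
  case: (LMl m m') => [|E|E]; first by rewrite mm' /=.
    by rewrite (sum_sign_count sizeL E) mul0r.
  by rewrite (sum_sign_count sizeM E) mulr0.
split=> // m m'; rewrite neq_ltn => /orP[/orth|/orth] E.
  by apply/orthogonal_squares_sign.
apply/orthogonal_squares_sign => //.
by under eq_bigr do rewrite addbC.
Qed.

Lemma product_relationP :
  [/\ is_relation product_squares product_relation,
      square_nontrivial product_relation,
      #|product_relation (first_col k)| = count (word_parity k) L &
      #|product_relation (second_col k)| = count (word_parity k) M].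
Proof.
split.
- move=> ij; rewrite odd_card_columns /= !inE.
  under eq_bigr do rewrite inE eqb_id mxE.
  by rewrite big_split /= addbb.
- by move=> m [] /setP; [move/(_ true)|move/(_ false)]; rewrite !inE.
- exact: card_nth_count.
- exact: card_nth_count.
Qed.

End ProductSquares.

(** * Explicit lists of words and their letter counts *)

Lemma word_parity1 w : word_parity 1 w = nth false w 0.
Proof. by rewrite /word_parity big_ord1. Qed.

Lemma word_parity2 w : word_parity 2 w = nth false w 0 (+) nth false w 1.
Proof. by rewrite /word_parity !big_ord_recl big_ord0 addbF. Qed.

Lemma word_parity3 w :
  word_parity 3 w = nth false w 0 (+) nth false w 1 (+) nth false w 2.
Proof. by rewrite /word_parity !big_ord_recl big_ord0 addbF addbA. Qed.

Local Close Scope ring_scope.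

Definition words1 (l : nat) : seq (seq bool) :=
  nseq l [:: true] ++ nseq l [:: false].

(** Complementary words have equal multiplicity, which balances both letters; [a] and [c] are the
    numbers of pairs of odd and of even parity. *)
Definition words2 (a c : nat) : seq (seq bool) :=
  nseq a [:: false; true] ++ nseq a [:: true; false] ++
  nseq c [:: false; false] ++ nseq c [:: true; true].

(* The first two letters are balanced among the words of each parity.  When a
   and c are odd, the sum of letters 0 and 1 cannot be balanced as well; this
   is harmless because [rev] moves the defect to another pair of squares. *)
Definition words3 (a c : nat) : seq (seq bool) :=
  let h := uphalf a in let d := uphalf c in
  nseq h [:: false; false; true] ++ nseq h [:: true; true; true] ++
  nseq (a - h) [:: false; true; false] ++
  nseq (a - h) [:: true; false; false] ++
  nseq d [:: false; false; false] ++ nseq d [:: true; true; false] ++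
  nseq (c - d) [:: false; true; true] ++ nseq (c - d) [:: true; false; true].

Lemma words1_count l :
  [/\ size (words1 l) = 2 * l, count (nth false ^~ 0) (words1 l) = l &
      count (word_parity 1) (words1 l) = l].
Proof.
rewrite (eq_count word_parity1) /words1 size_cat !size_nseq.
by rewrite count_cat !count_nseq /=; split; lia.
Qed.

Lemma words2_count a c :
  [/\ size (words2 a c) = 2 * (a + c),
      forall m, m < 2 -> count (nth false ^~ m) (words2 a c) = a + c,
      count (fun w => nth false w 0 (+) nth false w 1) (words2 a c) = 2 * a &
      count (word_parity 2) (words2 a c) = 2 * a].
Proof.
rewrite (eq_count word_parity2) /words2 !size_cat !size_nseq.
split; rewrite ?count_cat ?count_nseq /=; try lia.
by move=> [|[|//]] _; rewrite !count_cat !count_nseq /=; lia.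
Qed.

(** As [a] and [c] have the same parity, rounding up in both [h] and [d] compensates in the last
    letter: 2h + 2(c - d) = a + c. *)
Lemma words3_count a c : ~~ odd (a + c) ->
  [/\ size (words3 a c) = 2 * (a + c),
      forall m, m < 3 -> count (nth false ^~ m) (words3 a c) = a + c,
      count (fun w => nth false w 0 (+) nth false w 2) (words3 a c) = a + c,
      count (fun w => nth false w 1 (+) nth false w 2) (words3 a c) = a + c &
      count (word_parity 3) (words3 a c) = 2 * a].
Proof.
move=> ac; rewrite (eq_count word_parity3) /words3 !size_cat !size_nseq.
split; rewrite ?count_cat ?count_nseq /=; try lia.
by move=> [|[|[|//]]] _; rewrite !count_cat !count_nseq /=; lia.
Qed.

(** Reversal keeps the parity of a word and carries the balanced sum of letters 1 and 2 to letters 0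
    and 1. *)
Lemma words3_rev_count a c : ~~ odd (a + c) ->
  let M := map rev (words3 a c) in
  [/\ size M = 2 * (a + c),
      forall m, m < 3 -> count (nth false ^~ m) M = a + c,
      count (fun w => nth false w 0 (+) nth false w 1) M = a + c &
      count (word_parity 3) M = 2 * a].
Proof.
move=> ac M; rewrite (eq_count word_parity3) {}/M /words3 !map_cat !map_nseq.
rewrite !size_cat !size_nseq /rev /=.
split; rewrite ?count_cat ?count_nseq /=; try lia.
by move=> [|[|[|//]]] _; rewrite !count_cat !count_nseq /=; lia.
Qed.

(** * Necessary conditions for one, two and three squares *)

Lemma relation_odd k l (F : 'I_k -> 'M[bool]_(2 * l)) X :
  0 < l -> is_MOFS F -> is_relation F X -> square_nontrivial X ->
  odd #|X (first_col k)| = odd (k * l) /\ odd #|X (second_col k)| = odd (k * l).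
Proof.
move=> l0 FM FX X0; have [e Fe] := relation_addb FX X0.
by split; [exact: odd_relation_rows Fe l0|exact: odd_relation_cols Fe l0].
Qed.

Lemma relation1_half l (F : 'I_1 -> 'M[bool]_(2 * l)) X :
  0 < l -> is_MOFS F -> is_relation F X -> square_nontrivial X ->
  #|X (first_col 1)| = l /\ #|X (second_col 1)| = l.
Proof.
move=> l0 [/(_ ord0)/freq_square_sign[Fr Fc] _] FX X0.
have z : 'I_(2 * l) by exists 0; lia.
have [e Fe] := relation_addb FX X0.
have := sum_addb_row Fe z; have := sum_addb_col Fe z.
under eq_bigr do rewrite big_ord1.
rewrite Fc => /esym/eqP; rewrite mulf_eq0 signr_eq0 /= => /eqP Ha.
under eq_bigr do rewrite big_ord1.
rewrite Fr => /esym/eqP; rewrite mulf_eq0 signr_eq0 /= => /eqP Hb.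
by split; lia.
Qed.

Lemma relation2_half l (F : 'I_2 -> 'M[bool]_(2 * l)) X :
  is_MOFS F -> is_relation F X -> square_nontrivial X ->
  #|X (first_col 2)| = l \/ #|X (second_col 2)| = l.
Proof.
move=> [Ff Fo] FX X0; have [e Fe] := relation_addb FX X0.
have /(orthogonal_squares_sign (Ff _) (Ff _)) := Fo ord0 (lift ord0 ord0) isT.
have := sum_addb_cells Fe.
under eq_bigr do rewrite !big_ord_recl big_ord0 addbF.
move=> -> /eqP; rewrite !mulf_eq0 signr_eq0 /=.
by case/orP => /eqP H; [left|right]; lia.
Qed.

(* Summing (1 - f)(1 - g)(1 - h) over the cells, where f, g, h are the squares
   with symbols 1 and -1, kills all terms but the first and the last. *)
Lemma MOFS3_sum_sign l (F : 'I_3 -> 'M[bool]_(2 * l)) : is_MOFS F ->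
  exists t : int,
    (\sum_ij (-1) ^+ (\big[addb/false]_(m < 3) F m ij.1 ij.2) =
     4 * l%:Z * l%:Z - 8 * t :> int)%R.
Proof.
move=> [Ff Fo].
pose m1 : 'I_3 := lift ord0 ord0; pose m2 : 'I_3 := lift ord0 (lift ord0 ord0).
pose f m ij := F m ij.1 ij.2.
(* The witness counts the cells where all three symbols are 1: there the product of the three
   factors is 8, elsewhere it is 0. *)
exists (\sum_ij (f ord0 ij && f m1 ij && f m2 ij)%:Z)%R.
have F1 m : (\sum_ij (-1) ^+ f m ij = 0 :> int)%R := freq_square_total (Ff m).
have F2 m m' : m != m' -> (\sum_ij (-1) ^+ (f m ij (+) f m' ij) = 0 :> int)%R.
  by move=> /Fo/(orthogonal_squares_sign (Ff _) (Ff _)).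
have := cardT_sumz ('I_(2 * l) * 'I_(2 * l))%type.
rewrite card_prod card_ord => E.
have -> : (4 * l%:Z * l%:Z = \sum_(ij : 'I_(2 * l) * 'I_(2 * l)) 1 :> int)%R.
  by rewrite -E; lia.
transitivity (\sum_ij (1 - 8 * (f ord0 ij && f m1 ij && f m2 ij)%:Z
   - (-1) ^+ f ord0 ij - (-1) ^+ f m1 ij - (-1) ^+ f m2 ij
   + (-1) ^+ (f ord0 ij (+) f m1 ij) + (-1) ^+ (f ord0 ij (+) f m2 ij)
   + (-1) ^+ (f m1 ij (+) f m2 ij)) : int)%R.
  apply: eq_bigr => ij _; rewrite !big_ord_recl big_ord0 addbF -/m1 -/m2.
  by rewrite -!/(f _ ij); case: (f ord0 ij) (f m1 ij) (f m2 ij) => [] [] [].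
by rewrite !big_split /= !sumrN !F1 !F2 // -mulr_sumr !oppr0 !addr0.
Qed.

Lemma relation3_even l (F : 'I_3 -> 'M[bool]_(2 * l)) X :
  0 < l -> is_MOFS F -> is_relation F X -> square_nontrivial X -> ~~ odd l.
Proof.
move=> l0 FM FX X0; have [e Fe] := relation_addb FX X0.
have [oa ob] := relation_odd l0 FM FX X0.
have [t] := MOFS3_sum_sign FM; rewrite (sum_addb_cells Fe).
move: oa ob; set a := #|_|; set b := #|_| => oa ob E.
apply/negP => ol.
(* For odd [l], both [a] and [b] are odd, so the left side of [E] is divisible by 16, whereas the
   right side is 4 modulo 8. *)
have [a' Ea] : exists a', a = a'.*2.+1 by exists a./2; lia.
have [b' Eb] : exists b', b = b'.*2.+1 by exists b./2; lia.
have [l' El] : exists l', l = l'.*2.+1 by exists l./2; lia.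
move: E; rewrite Ea Eb El; case: (e); rewrite ?expr0 ?expr1; nia.
Qed.

Theorem theorem2p7 (lambda a b : nat) (lambda_gt0 : 0 < lambda)
    (a_le : a <= 2 * lambda) (b_le : b <= 2 * lambda) :
  [/\ (exists (F : 'I_1 -> 'M[bool]_(2 * lambda)) (X : col_subsets (2 * lambda) 1),
         is_MOFS F /\
         [/\ is_relation F X, square_nontrivial X,
             #|X (first_col 1)| = a & #|X (second_col 1)| = b])
      <-> (a = lambda /\ b = lambda),
      (exists (F : 'I_2 -> 'M[bool]_(2 * lambda)) (X : col_subsets (2 * lambda) 2),
         is_MOFS F /\
         [/\ is_relation F X, square_nontrivial X,
             #|X (first_col 2)| = a & #|X (second_col 2)| = b])
      <-> ([/\ ~~ odd lambda, ~~ odd a & ~~ odd b] /\ (a = lambda \/ b = lambda))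
    & (exists (F : 'I_3 -> 'M[bool]_(2 * lambda)) (X : col_subsets (2 * lambda) 3),
         is_MOFS F /\
         [/\ is_relation F X, square_nontrivial X,
             #|X (first_col 3)| = a & #|X (second_col 3)| = b])
      <-> [/\ ~~ odd lambda, ~~ odd a & ~~ odd b]].
Proof.
split; split.
- move=> [F [X [FM [FX X0 <- <-]]]]; exact: relation1_half FM FX X0.
- case=> -> ->; have [sz cnt par] := words1_count lambda.
  exists (@product_squares 1 lambda (words1 lambda) (words1 lambda)).
  exists (@product_relation 1 lambda (words1 lambda) (words1 lambda)).
  split; first by apply: product_MOFS => // -[|m] // [|m'] //; lia.
  by have := product_relationP 1 sz sz; rewrite par.
- move=> [F [X [FM [FX X0 <- <-]]]].
  have [oa ob] := relation_odd lambda_gt0 FM FX X0.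
  have half := relation2_half FM FX X0.
  (* Both sizes have the parity of [2 * lambda], and [lambda] equals one of them. *)
  by move: oa ob half; rewrite oddM /= => oa ob half; split=> //;
    case: half => h; rewrite oa ob -{1}h ?oa ?ob.
- move=> [[ol oa ob] half].
  (* The bound on [a] makes the truncated subtraction exact. *)
  have [a2 al] : a = 2 * a./2 /\ a./2 + (lambda - a./2) = lambda by lia.
  have [b2 bl] : b = 2 * b./2 /\ b./2 + (lambda - b./2) = lambda by lia.
  have := words2_count a./2 (lambda - a./2); rewrite al -a2.
  have := words2_count b./2 (lambda - b./2); rewrite bl -b2.
  set M := words2 _ _; set L := words2 _ _.
  move=> [sM cM xM pM] [sL cL xL pL].
  exists (@product_squares 2 lambda L M), (@product_relation 2 lambda L M).
  split; last by have := product_relationP 2 sL sM; rewrite pL pM.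
  (* The sum of the two letters is 1 on [a] words of [L] and [b] words of [M], so [half] gives the
     orthogonality. *)
  by apply: product_MOFS => // -[|[|m]] [|[|m']]; lia.
- move=> [F [X [FM [FX X0 <- <-]]]].
  have ol := relation3_even lambda_gt0 FM FX X0.
  have [-> ->] := relation_odd lambda_gt0 FM FX X0.
  by split=> //; rewrite oddM.
- move=> [ol oa ob].
  have [a2 al] : a = 2 * a./2 /\ a./2 + (lambda - a./2) = lambda by lia.
  have [b2 bl] : b = 2 * b./2 /\ b./2 + (lambda - b./2) = lambda by lia.
  have := @words3_count a./2 (lambda - a./2); rewrite al -a2.
  have := @words3_rev_count b./2 (lambda - b./2); rewrite bl -b2.
  set M := map rev _; set L := words3 _ _.
  move=> /(_ ol) [sM cM xM pM] /(_ ol) [sL cL xL yL pL].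
  exists (@product_squares 3 lambda L M), (@product_relation 3 lambda L M).
  split; last by have := product_relationP 3 sL sM; rewrite pL pM.
  (* [L] makes square 2 orthogonal to squares 0 and 1; [M] settles the pair 0, 1. *)
  by apply: product_MOFS => // -[|[|[|m]]] [|[|[|m']]]; lia.
Qed.
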